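(* The procedure $\mathcal A_{\mathsf{PPL}}$ described in the context is an algorithm (its execution terminates on every input $\varphi\in L_{\mathsf{PPL}}$). Moreover, it is correct: on input $\varphi\in L_{\mathsf{PPL}}$ it returns true if $\varphi$ is valid in $\mathsf{PPL}$ (i.e. $\vDash\varphi$) and returns false otherwise.
   Context: **Classical part.** $B=\{B_j: j\in\mathbb N\}$ is a denumerable set of propositional symbols; $L$ is the set of propositional formulas generated from $B$ by $\neg,\supset$ (other connectives are abbreviations). A valuation $v:B\to\{0,1\}$ is identified with $\{B_j: v(B_j)=1\}$; $\Vdash_c,\vDash_c$ are classical satisfaction and entailment. $B_\alpha$ is the set of symbols occurring in $\alpha$; $[\![\alpha]\!]=\{v\cap B_\alpha: v\Vdash_c\alpha\}$. For finite $A\subseteq B$ and $U\subseteq A$, $\phi_A^U$ is $\big(\bigwedge_{B_j\in U}B_j\big)\wedge\big(\bigwedge_{B_j\in A\setminus U}\neg B_j\big)$. **Stochastic valuations.** A stochastic valuation $V$ is a family $\{V_{B_j}\}_{B_j\in B}$ of random variables on a probability space $(\Omega,\mathcal F,\mu)$, $V_{B_j}$ taking values in $\{\emptyset,\{B_j\}\}$ (false/true). For finite non-empty $A\subseteq B$, $U\subseteq A$: $\mathrm{Prob}(V_A=U)=\mu\big(\bigcap_{B_j\in A}V_{B_j}^{-1}(U\cap\{B_j\})\big)$. $\mathrm{Prob}_V(\alpha)=\sum_{U\in[\![\alpha]\!]}\mathrm{Prob}(V_{B_\alpha}=U)$. **RCOF.** $\mathsf{RCOF}$ is the (decidable) first-order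 theory of real closed ordered fields over $0,1,-,+,\times,=,<$ (its theorems are exactly the sentences true in $\mathbb R$), with variables $X=\{x_k:k\in\mathbb N\}\cup\{x_\alpha:\alpha\in L\}$. $T_{\mathsf{RCOF}}$ is the set of its terms using no variable $x_\alpha$ with $\alpha\in L$. $t^{\mathbb R\rho}$ is the value of term $t$ in $\mathbb R$ under $\rho:X\to\mathbb R$. **PPL.** $L_{\mathsf{PPL}}$ is generated by: $\int\alpha\mathbin{@}p\in L_{\mathsf{PPL}}$ for $\alpha\in L$, $p\in T_{\mathsf{RCOF}}$, $@\in\{=,<\}$; and $\varphi_1\supset\varphi_2\in L_{\mathsf{PPL}}$ for $\varphi_1,\varphi_2\in L_{\mathsf{PPL}}$. $V\rho\Vdash\int\alpha\mathbin{@}p$ iff $\mathrm{Prob}_V(\alpha)\mathbin{@}p^{\mathbb R\rho}$; $V\rho\Vdash\varphi_1\supset\varphi_2$ iff $V\rho\not\Vdash\varphi_1$ or $V\rho\Vdash\varphi_2$. $\vDash\varphi$ means $V\rho\Vdash\varphi$ for all stochastic valuations $V$ and all $\rho:X\to\mathbb R$. **Given algorithms.** $\mathcal A_{\mathrm{DNF}}$ is an algorithm that receives $\alpha\in L$ and a set $A\supseteq B_\alpha$ of propositional symbols and returns a set $\{\beta_1,\dots,\beta_m\}$ of conjunctions of literals such that $B_{\beta_i}=A$ for each $i$, $\beta_1\vee\dots\vee\beta_m$ is a disjunctive normal form of $\alpha$, and $\not\vDash_c\beta_i\equiv\beta_j$ for $1\le i\ne j\le m$. $\mathcal A_{\mathsf{RCOF}}$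 is an algorithm for deciding the validity of sentences in $\mathsf{RCOF}$ (returning true or false). **Procedure $\mathcal A_{\mathsf{PPL}}$**, on input $\varphi\in L_{\mathsf{PPL}}$: 1. let $B_\varphi$ be the set of propositional symbols occurring in $\varphi$; 2. let $\{\alpha_1,\dots,\alpha_k\}$ be the set of $\alpha\in L$ such that some $\int\alpha\mathbin{@}p$ occurs in $\varphi$; 3. let $\psi$ be the $\mathsf{RCOF}$ formula obtained from $\varphi$ by replacing each $\int\alpha\mathbin{@}p$ by $x_\alpha\mathbin{@}p$; 4. for each $j=1,\dots,k$ let $\{\alpha_{j1},\dots,\alpha_{jm_j}\}:=\mathcal A_{\mathrm{DNF}}(\alpha_j,B_\varphi)$; 5. return $\mathcal A_{\mathsf{RCOF}}$ applied to the universal closure of $Q\supset\psi$, where $Q$ is $$\Big(\bigwedge_{U\subseteq B_\varphi}0\le x_{\phi^U_{B_\varphi}}\le1\Big)\wedge\Big(\sum_{U\subseteq B_\varphi}x_{\phi^U_{B_\varphi}}=1\Big)\wedge\bigwedge_{j=1}^k\Big(x_{\alpha_j}=\sum_{\ell=1}^{m_j}x_{\alpha_{j\ell}}\Big).$$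
   Formalization: The conjunctions of literals returned by A_DNF are required to contain no complementary literals and to be written in the same fixed order as the formulas φ_A^U; otherwise Q leaves some x_{α_jl} unconstrained (e.g. B1∧¬B1 returned for itself) and the procedure is incorrect. *)

(* Defs.v *)
From HB Require Import structures.
From mathcomp Require Import all_boot all_order all_algebra finmap.
From mathcomp Require Import all_classical all_reals all_analysis.

Set Implicit Arguments.
Unset Strict Implicit.
Unset Printing Implicit Defensive.

Import Order.TTheory GRing.Theory Num.Theory.

(* A possibly non-terminating computation: at each step it either returns
   ([Now]) or carries on ([Later]); an execution that never returns is an
   infinite sequence of [Later] (Capretta's delay monad).  A procedure from [I]
   to [O] is a function [I -> delay O], and termination on an input is a
   property of the resulting computation, not a consequence of its type. *)
CoInductive delay (T : Type) : Type :=
| Now of T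
| Later of delay T.

Inductive returns (T : Type) : delay T -> T -> Prop :=
| returns_Now x : returns (Now x) x
| returns_Later d x : returns d x -> returns (Later d) x.

Definition terminates (T : Type) (d : delay T) : Prop := exists x, returns d x.

CoFixpoint dbind (T U : Type) (d : delay T) (f : T -> delay U) : delay U :=
  match d with
  | Now x => f x
  | Later d' => Later (dbind d' f)
  end.

Notation "'run' x ':=' d 'in' e" := (dbind d (fun x => e))
  (at level 200, x name, d at level 200, e at level 200).

Fixpoint drun_all (T U : Type) (f : T -> delay U) (s : seq T) :
    delay (seq (T * U)) :=
  match s with
  | [::] => Now [::]
  | x :: s' =>
      run y := f x in
      run ys := drun_all f s' in
      Now ((x, y) :: ys)
  end.

(* The propositional symbol B_j is represented by its index j. *)
Inductive pform : Type :=
| PVar of nat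
| PNeg of pform
| PImp of pform & pform.

Fixpoint pform_encode (a : pform) : GenTree.tree nat :=
  match a with
  | PVar j => GenTree.Leaf j
  | PNeg a => GenTree.Node 0 [:: pform_encode a]
  | PImp a b => GenTree.Node 1 [:: pform_encode a; pform_encode b]
  end.

Fixpoint pform_decode (t : GenTree.tree nat) : option pform :=
  match t with
  | GenTree.Leaf j => Some (PVar j)
  | GenTree.Node 0 [:: t] => omap PNeg (pform_decode t)
  | GenTree.Node 1 [:: t; u] =>
      obind (fun a => omap (PImp a) (pform_decode u)) (pform_decode t)
  | _ => None
  end.

Lemma pform_encodeK : pcancel pform_encode pform_decode.
Proof. by elim=> //= [a -> | a -> b ->]. Qed.

HB.instance Definition _ := Countable.copy pform (pcan_type pform_encodeK).

Definition POr (a b : pform) : pform := PImp (PNeg a) b.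
Definition PAnd (a b : pform) : pform := PNeg (PImp a (PNeg b)).
Definition PEquiv (a b : pform) : pform := PAnd (PImp a b) (PImp b a).

(* The language has no constant symbols: bottom and top, used only for empty
   disjunctions and conjunctions, are abbreviations. *)
Definition PTop : pform := PImp (PVar 0) (PVar 0).
Definition PBot : pform := PNeg PTop.

Fixpoint POr_seq (s : seq pform) : pform :=
  match s with
  | [::] => PBot
  | [:: a] => a
  | a :: s' => POr a (POr_seq s')
  end.

Fixpoint PAnd_seq (s : seq pform) : pform :=
  match s with
  | [::] => PTop
  | [:: a] => a
  | a :: s' => PAnd a (PAnd_seq s')
  end.

Definition pvaluation : Type := nat -> bool.

Fixpoint psat (v : pvaluation) (a : pform) : bool :=
  match a with
  | PVar j => v j
  | PNeg a => ~~ psat v a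
  | PImp a b => psat v a ==> psat v b
  end.

Definition pvalid (a : pform) : Prop := forall v : pvaluation, psat v a.

Fixpoint psyms (a : pform) : {fset nat} :=
  match a with
  | PVar j => [fset j]%fset
  | PNeg a => psyms a
  | PImp a b => (psyms a `|` psyms b)%fset
  end.

(* [[a]], the set of all v /\ B_a with v satisfying a. *)
Definition pden (a : pform) : set {fset nat} :=
  [set [fset j in psyms a | v j]%fset | v in [set v | psat v a]].

(* The conjunction of the symbols in P and of the negations of the symbols in N,
   each group in increasing order of indices; an empty group is omitted. *)
Definition litconj (P N : {fset nat}) : pform :=
  let pos := [seq PVar j | j <- sort leq P] in
  let neg := [seq PNeg (PVar j) | j <- sort leq N] in
  if nilp neg then PAnd_seq pos
  else if nilp pos then PAnd_seq neg
  else PAnd (PAnd_seq pos) (PAnd_seq neg).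

Definition phi (A U : {fset nat}) : pform := litconj U (A `\` U)%fset.

(* A (nonempty) conjunction of literals, written in the same fixed order as in
   [litconj] and without complementary literals; when its set of symbols is A it
   is thus syntactically some [phi A U], so that the variables x_{alpha_jl} of
   [Qform] are among the variables x_{phi A U}. *)
Definition is_litconj (b : pform) : Prop :=
  exists P N : {fset nat},
    [/\ [disjoint P & N]%fset, (P `|` N != fset0)%fset & b = litconj P N].

Definition is_dnf_algorithm
    (dnf : pform -> {fset nat} -> delay {fset pform}) : Prop :=
  forall (a : pform) (A : {fset nat}), (psyms a `<=` A)%fset ->
    exists S : {fset pform},
      [/\ returns (dnf a A) S,
          forall b, b \in S -> is_litconj b /\ psyms b = A,
          pvalid (PEquiv a (POr_seq S)) &
          forall b c, b \in S -> c \in S -> b <> c -> ~ pvalid (PEquiv b c)].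

(* [inl k] is x_k and [inr a] is x_a. *)
Definition rvar : Type := (nat + pform)%type.

Inductive rterm : Type :=
| RVar of rvar
| RZero
| ROne
| ROpp of rterm
| RAdd of rterm & rterm
| RMul of rterm & rterm.

Inductive rform : Type :=
| REq of rterm & rterm
| RLt of rterm & rterm
| RNeg of rform
| RImp of rform & rform
| RAll of rvar & rform.

Definition RAnd (f g : rform) : rform := RNeg (RImp f (RNeg g)).
Definition ROr (f g : rform) : rform := RImp (RNeg f) g.
Definition RLe (t u : rterm) : rform := ROr (RLt t u) (REq t u).

Fixpoint RAnd_seq (s : seq rform) : rform :=
  match s with
  | [::] => REq RZero RZero
  | [:: f] => f
  | f :: s' => RAnd f (RAnd_seq s')
  end.

Fixpoint RAdd_seq (s : seq rterm) : rterm :=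
  match s with
  | [::] => RZero
  | [:: t] => t
  | t :: s' => RAdd t (RAdd_seq s')
  end.

Fixpoint rterm_vars (t : rterm) : {fset rvar} :=
  match t with
  | RVar x => [fset x]%fset
  | RZero | ROne => fset0
  | ROpp t => rterm_vars t
  | RAdd t u | RMul t u => (rterm_vars t `|` rterm_vars u)%fset
  end.

Fixpoint rform_fv (f : rform) : {fset rvar} :=
  match f with
  | REq t u | RLt t u => (rterm_vars t `|` rterm_vars u)%fset
  | RNeg f => rform_fv f
  | RImp f g => (rform_fv f `|` rform_fv g)%fset
  | RAll x f => (rform_fv f `\ x)%fset
  end.

Definition is_sentence (f : rform) : Prop := rform_fv f = fset0.

Definition RAll_closure (f : rform) : rform :=
  foldr RAll f (rform_fv f).

Section RcofSemantics.
Local Open Scope ring_scope.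
Variable R : realType.

Fixpoint rterm_val (rho : rvar -> R) (t : rterm) : R :=
  match t with
  | RVar x => rho x
  | RZero => 0
  | ROne => 1
  | ROpp t => - rterm_val rho t
  | RAdd t u => rterm_val rho t + rterm_val rho u
  | RMul t u => rterm_val rho t * rterm_val rho u
  end.

Fixpoint rsat (rho : rvar -> R) (f : rform) : Prop :=
  match f with
  | REq t u => rterm_val rho t = rterm_val rho u
  | RLt t u => rterm_val rho t < rterm_val rho u
  | RNeg f => ~ rsat rho f
  | RImp f g => rsat rho f -> rsat rho g
  | RAll x f => forall r : R, rsat (fun y => if y == x then r else rho y) f
  end.

(* The theorems of RCOF are exactly the sentences true in the reals. *)
Definition rcof_valid (f : rform) : Prop := forall rho : rvar -> R, rsat rho f.

Definition is_rcof_algorithm (rcof : rform -> delay bool) : Prop :=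
  forall f : rform, is_sentence f ->
    exists b : bool, returns (rcof f) b /\ (b = true <-> rcof_valid f).

End RcofSemantics.

Definition no_pform_var (t : rterm) : bool :=
  all (fun x => if x is inl _ then true else false) (rterm_vars t).

Definition trcof : Type := {t : rterm | no_pform_var t}.

Inductive pplform : Type :=
| PplEq of pform & trcof
| PplLt of pform & trcof
| PplImp of pplform & pplform.

Section PplSemantics.
Local Open Scope classical_set_scope.
Local Open Scope ring_scope.
Variable R : realType.

(* The values of V_{B_j}, the empty set and {B_j}, are represented by [false]
   and [true]; so U /\ {B_j} is represented by [j \in U]. *)
Record stochastic_valuation : Type := StochasticValuation {
  sv_display : measure_display;
  sv_space : measurableType sv_display;
  sv_prob : probability sv_space R;
  sv_var :> nat -> {RV sv_prob >-> bool}
}.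

Definition prob_eq (V : stochastic_valuation) (A U : {fset nat}) : R :=
  fine (sv_prob V (\bigcap_(j in [set` A]) (V j @^-1` [set (j \in U)]))).

Definition prob (V : stochastic_valuation) (a : pform) : R :=
  \sum_(U \in pden a) prob_eq V (psyms a) U.

Fixpoint ppl_sat (V : stochastic_valuation) (rho : rvar -> R) (f : pplform) :
    Prop :=
  match f with
  | PplEq a p => prob V a = rterm_val rho (sval p)
  | PplLt a p => prob V a < rterm_val rho (sval p)
  | PplImp f g => ~ ppl_sat V rho f \/ ppl_sat V rho g
  end.

Definition ppl_valid (f : pplform) : Prop :=
  forall (V : stochastic_valuation) (rho : rvar -> R), ppl_sat V rho f.

End PplSemantics.

Fixpoint ppl_syms (f : pplform) : {fset nat} :=
  match f with
  | PplEq a _ | PplLt a _ => psyms a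
  | PplImp f g => (ppl_syms f `|` ppl_syms g)%fset
  end.

Fixpoint ppl_pforms (f : pplform) : {fset pform} :=
  match f with
  | PplEq a _ | PplLt a _ => [fset a]%fset
  | PplImp f g => (ppl_pforms f `|` ppl_pforms g)%fset
  end.

Definition xvar (a : pform) : rterm := RVar (inr a).

Fixpoint ppl_to_rcof (f : pplform) : rform :=
  match f with
  | PplEq a p => REq (xvar a) (sval p)
  | PplLt a p => RLt (xvar a) (sval p)
  | PplImp f g => RImp (ppl_to_rcof f) (ppl_to_rcof g)
  end.

(* [ds] lists the pairs (alpha_j, {alpha_j1, ..., alpha_jm_j}). *)
Definition Qform (A : {fset nat}) (ds : seq (pform * {fset pform})) : rform :=
  let xs := [seq xvar (phi A U) | U <- fpowerset A] in
  RAnd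
    (RAnd (RAnd_seq [seq RAnd (RLe RZero x) (RLe x ROne) | x <- xs])
          (REq (RAdd_seq xs) ROne))
    (RAnd_seq [seq REq (xvar d.1) (RAdd_seq [seq xvar b | b <- enum_fset d.2])
              | d <- ds]).

Definition A_PPL (dnf : pform -> {fset nat} -> delay {fset pform})
    (rcof : rform -> delay bool) (f : pplform) : delay bool :=
  let B := ppl_syms f in
  let alphas := ppl_pforms f in
  let psi := ppl_to_rcof f in
  run ds := drun_all (fun a => dnf a B) alphas in
  rcof (RAll_closure (RImp (Qform B ds) psi)).

(* Main.v *)
From HB Require Import structures.
Require Import Defs.
From mathcomp Require Import all_boot all_order all_algebra finmap.
From mathcomp Require Import all_classical all_reals all_analysis.

(* An RCOF assignment satisfying Q restricts, on the variables x_{phi_B^U}, to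
   a probability distribution on the subsets U of B = B_phi, and Q then forces
   the values of the x_{alpha_j}.  Conversely every stochastic valuation V gives
   such an assignment, x_alpha := Prob_V(alpha): the disjuncts of a disjunctive
   normal form over B are pairwise incompatible, so their probabilities add up.
   A distribution on the subsets of B is realized by a stochastic valuation on
   a finitely supported discrete probability space; hence phi is valid in PPL
   iff Q implies psi under every real assignment. *)

Set Implicit Arguments.
Unset Strict Implicit.
Unset Printing Implicit Defensive.

Import Order.TTheory GRing.Theory Num.Theory.

(** * Computations in the delay monad *)

(** A cofixpoint unfolds only under a [match], so the equation is reached through the identity
    [match] on the computation. *)
Lemma dbindE (T U : Type) (d : delay T) (f : T -> delay U) :
  dbind d f = match d with Now x => f x | Later d' => Later (dbind d' f) end.
Proof.
rewrite [LHS](_ : _ = match dbind d f with Now y => Now y | Later e => Later e end).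
  by case: d => //= x; case: (f x).
by case: (dbind d f).
Qed.

Lemma returns_dbind (T U : Type) (d : delay T) (f : T -> delay U) x y :
  returns d x -> returns (f x) y -> returns (dbind d f) y.
Proof.
elim=> [{}x|{}d {}x _ IH] fx; rewrite dbindE //.
by constructor; apply: IH.
Qed.

Lemma returns_drun_all (T U : eqType) (f : T -> delay U)
    (P : T -> U -> Prop) (s : seq T) :
  (forall x, x \in s -> exists2 y, returns (f x) y & P x y) ->
  exists ys, [/\ returns (drun_all f s) ys, unzip1 ys = s &
    {in ys, forall i, P i.1 i.2}].
Proof.
elim: s => [|x s IH] fP; first by exists [::]; split=> //; constructor.
have [y fxy Pxy] := fP x (mem_head _ _).
have [|ys [sys Es Pys]] := IH.
  by move=> z zs; apply: fP; rewrite inE zs orbT.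
exists ((x, y) :: ys); split=> /=; last 2 first.
- by rewrite Es.
- by move=> i; rewrite inE => /predU1P[->|/Pys].
by apply: (returns_dbind fxy); apply: (returns_dbind sys); constructor.
Qed.

(** * Literal conjunctions and classical semantics *)

Lemma psat_POr_seq v s : psat v (POr_seq s) = has (psat v) s.
Proof.
elim: s => [|a [|b s] IH]; first by rewrite /= implybb.
  by rewrite /= orbF.
by rewrite -[RHS]/(psat v a || has (psat v) (b :: s)) -IH /= implybE negbK.
Qed.

Lemma psat_PAnd_seq v s : psat v (PAnd_seq s) = all (psat v) s.
Proof.
elim: s => [|a [|b s] IH]; first by rewrite /= implybb.
  by rewrite /= andbT.
by rewrite -[RHS]/(psat v a && all (psat v) (b :: s)) -IH /= negb_imply negbK.
Qed.

(** The empty conjunction is [PTop], in which the symbol of index 0 occurs; hence the restriction to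
    non-empty lists. *)
Lemma psyms_PAnd_seq s j :
  s != [::] -> (j \in psyms (PAnd_seq s)) = has (fun a => j \in psyms a) s.
Proof.
elim: s => [//|a [|b s] IH _]; first by rewrite /= orbF.
rewrite -[RHS]/((j \in psyms a) || has (fun a => j \in psyms a) (b :: s)).
by rewrite -IH //= inE.
Qed.

Lemma psyms_litconj P N :
  (P `|` N != fset0)%fset -> psyms (litconj P N) = (P `|` N)%fset.
Proof.
have E j (X : {fset nat}) g :
    has (fun a => j \in psyms a) [seq g (PVar i) | i <- sort leq X] =
    has (fun i => j \in psyms (g (PVar i))) X.
  by rewrite has_map; apply: eq_has_r => i; rewrite mem_sort.
have nilpE (X : {fset nat}) (g : nat -> pform) :
    nilp [seq g i | i <- sort leq X] = (X == fset0).
  by rewrite /nilp size_map size_sort cardfs_eq0.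
have nnil (X : {fset nat}) (g : nat -> pform) :
    X != fset0 -> [seq g i | i <- sort leq X] != [::].
  by rewrite -(nilpE X g) /nilp size_eq0.
have hasE j (X : {fset nat}) :
    has (fun i => j \in [fset i]%fset) X = (j \in X).
  by apply/hasP/idP => [[i iX /fset1P ->]//|jX]; exists j; rewrite // inE.
rewrite /litconj /= !nilpE => PN0; apply/fsetP => j; rewrite inE.
case: eqP => [N0|/eqP N0].
  rewrite N0 fsetU0 in PN0 *.
  by rewrite psyms_PAnd_seq ?nnil// (E _ _ id) hasE inE orbF.
case: eqP => [P0|/eqP P0].
  by rewrite P0 psyms_PAnd_seq ?nnil// (E _ _ PNeg) hasE inE.
by rewrite /= inE !psyms_PAnd_seq ?nnil// (E _ _ id) (E _ _ PNeg) !hasE.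
Qed.

Lemma psat_litconj v P N : psat v (litconj P N) = all v P && all (predC v) N.
Proof.
rewrite /litconj.
have pE : psat v (PAnd_seq [seq PVar j | j <- sort leq P]) = all v P.
  by rewrite psat_PAnd_seq all_map; apply: eq_all_r => i; rewrite mem_sort.
have nE : psat v (PAnd_seq [seq PNeg (PVar j) | j <- sort leq N]) =
    all (predC v) N.
  by rewrite psat_PAnd_seq all_map; apply: eq_all_r => i; rewrite mem_sort.
case: nilP => [n0|_]; first by rewrite pE -nE n0 /= implybb andbT.
case: nilP => [p0|_]; first by rewrite nE -pE p0 /= implybb.
by rewrite /= pE nE negb_imply negbK.
Qed.

(** Each valuation thus satisfies [phi A U] for exactly one part [U] of [A], its trace on [A]. The
    incompatibility and covering arguments below rest on this. *)
Lemma psat_phi v A U : (U `<=` A)%fset ->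
  psat v (phi A U) = ([fset j in A | v j]%fset == U).
Proof.
move=> UA; rewrite psat_litconj; apply/andP/eqP => [[/allP vU /allP vN]|<-].
  apply/fsetP => j; rewrite !inE /=; apply/andP/idP => [[jA vj]|jU].
    by apply: contraLR vj => jU; apply: vN; rewrite !inE jU.
  by split; [exact: (fsubsetP UA)|exact: vU].
by split; apply/allP => j; rewrite !inE /= => /andP[] // => + jA; rewrite jA.
Qed.

Lemma psyms_phi A U :
  A != fset0 -> (U `<=` A)%fset -> psyms (phi A U) = A.
Proof.
move=> A0 UA; have UDU : (U `|` A `\` U = A)%fset.
  apply/fsetP => j; rewrite !inE; case: (boolP (j \in U)) => //= jU.
  by rewrite (fsubsetP UA).
by rewrite psyms_litconj UDU.
Qed.

(** The equality has to be syntactic, because the variables x_alpha are indexed by formulas and not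
    by equivalence classes. *)
Lemma is_litconj_phi b : is_litconj b ->
  exists2 U, (U `<=` psyms b)%fset & b = phi (psyms b) U.
Proof.
move=> [P [N [PN PN0 ->]]]; rewrite psyms_litconj//.
exists P; first exact: fsubsetUl.
by rewrite /phi fsetDUl fsetDv fset0U (fsetDidPl _ _ _) // fdisjoint_sym.
Qed.

Lemma pden_finite a : finite_set (pden a).
Proof.
apply: (@sub_finite_set _ _ [set` fpowerset (psyms a)]) => // _ [v _ <-] /=.
by rewrite fpowersetE; apply: fset_sub.
Qed.

Lemma eq_psat v w a : {in psyms a, v =1 w} -> psat v a = psat w a.
Proof.
elim: a => [j|a IH|a IHa b IHb] /= vw; first by apply: vw; rewrite inE.
  by rewrite IH.
by rewrite IHa ?IHb// => j ja; apply: vw; rewrite inE ja ?orbT.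
Qed.

(** A valuation [w] witnessing membership in [pden a] may differ from [v], but only outside
    [psyms a], where satisfaction of [a] is insensitive. *)
Lemma psat_pden v a : psat v a <-> pden a [fset j in psyms a | v j]%fset.
Proof.
split=> [va|[w wa /fsetP E]]; first by exists v.
rewrite (@eq_psat v w)// => j ja.
by have := E j; rewrite !inE /= ja.
Qed.

Lemma ppl_syms_neq0 f : ppl_syms f != fset0.
Proof.
have sym a : psyms a != fset0.
  elim: a => [j|a //|a IHa b IHb] /=.
    by apply/fset0Pn; exists j; rewrite inE.
  by rewrite fsetU_eq0 negb_and IHa.
by elim: f => //= f IHf g _; rewrite fsetU_eq0 negb_and IHf.
Qed.

Lemma psyms_ppl_pforms f a :
  a \in ppl_pforms f -> (psyms a `<=` ppl_syms f)%fset.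
Proof.
elim: f => [b p|b p|f IHf g IHg] /=; do ?by rewrite inE => /eqP->.
rewrite inE => /orP[/IHf|/IHg] af; apply: fsubset_trans af _.
  exact: fsubsetUl.
exact: fsubsetUr.
Qed.

(** * Semantics of RCOF formulas *)

Lemma rsat_RAnd (R : realType) (rho : rvar -> R) f g :
  rsat rho (RAnd f g) <-> rsat rho f /\ rsat rho g.
Proof.
split=> [H|[rf rg] H]; last exact: H rf rg.
by split; apply: contrapT => H'; apply: H.
Qed.

Lemma rsat_RLe (R : realType) (rho : rvar -> R) t u :
  rsat rho (RLe t u) <-> (rterm_val rho t <= rterm_val rho u)%R.
Proof.
rewrite /= le_eqVlt; split=> [H|/predU1P[//|tu] /(_ tu)//].
case: ltP => tu; first by rewrite orbT.
by rewrite H ?eqxx//; apply/negP; rewrite -leNgt.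
Qed.

Lemma rsat_RAnd_seq (R : realType) (rho : rvar -> R) (T : eqType)
    (F : T -> rform) s :
  rsat rho (RAnd_seq [seq F x | x <- s]) <-> {in s, forall x, rsat rho (F x)}.
Proof.
elim: s => [|x [|y s] IH]; first by split.
  by split=> [Fx z|]; [rewrite inE => /eqP->|apply; rewrite mem_head].
have -> : RAnd_seq [seq F x | x <- [:: x, y & s]] =
  RAnd (F x) (RAnd_seq [seq F x | x <- y :: s]) by [].
rewrite rsat_RAnd IH; split=> [[Fx Fs] z|Fs].
  by rewrite inE => /predU1P[->|/Fs].
by split=> [|z zs]; apply: Fs; rewrite ?mem_head// inE zs orbT.
Qed.

Lemma rterm_val_RAdd_seq (R : realType) (rho : rvar -> R) (T : Type)
    (F : T -> rterm) s :
  rterm_val rho (RAdd_seq [seq F x | x <- s]) =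
  (\sum_(x <- s) rterm_val rho (F x))%R.
Proof.
elim: s => [|x [|y s] IH]; first by rewrite big_nil.
  by rewrite big_seq1.
by rewrite big_cons -IH.
Qed.

Lemma is_sentence_RAll_closure f : is_sentence (RAll_closure f).
Proof.
have E s g : rform_fv (foldr RAll g s) = (rform_fv g `\` [fset x in s])%fset.
  elim: s => [|x s IH] /=; apply/fsetP => y; rewrite ?IH !inE //.
  by rewrite negb_or andbA.
by rewrite /is_sentence E; apply/fsetP => y; rewrite !inE andNb.
Qed.

Lemma rcof_valid_RAll_closure (R : realType) f :
  rcof_valid R (RAll_closure f) <-> rcof_valid R f.
Proof.
rewrite /RAll_closure; elim: (enum_fset _) => //= x s <-.
split=> [H rho|H rho r]; last exact: H.
(* Updating [rho] at [x] with its own value [rho x] changes nothing, so the quantified hypothesis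
   applies to [rho] itself. *)
rewrite (_ : rho = fun y => if y == x then rho x else rho y); first exact: H.
by apply/funext => y; case: eqP => [->|].
Qed.

Lemma eq_rterm_val (R : realType) (rho rho' : rvar -> R) t :
  {in rterm_vars t, rho =1 rho'} -> rterm_val rho t = rterm_val rho' t.
Proof.
elim: t => [x|||t IHt|t IHt u IHu|t IHt u IHu] //= E.
- by apply: E; rewrite inE.
- by rewrite IHt.
- by rewrite IHt ?IHu// => x xt; apply: E; rewrite inE xt ?orbT.
- by rewrite IHt ?IHu// => x xt; apply: E; rewrite inE xt ?orbT.
Qed.

(** The terms of a PPL formula contain no variable x_alpha, so their values depend only on the x_k,
    where the two assignments agree. *)
Lemma rsat_ppl_to_rcof (R : realType) (V : stochastic_valuation R)
    (rho rho' : rvar -> R) f :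
  (forall k, rho' (inl k) = rho (inl k)) ->
  {in ppl_pforms f, forall a, rho' (inr a) = prob V a} ->
  rsat rho' (ppl_to_rcof f) <-> ppl_sat V rho f.
Proof.
move=> rhol.
have vE (p : trcof) : rterm_val rho' (sval p) = rterm_val rho (sval p).
  apply: eq_rterm_val => x xp; have := allP (svalP p) _ xp.
  by case: x {xp} => [k _|//]; exact: rhol.
elim: f => [a p|a p|f IHf g IHg] /= rhoV; rewrite ?vE ?rhoV ?inE//.
rewrite -implyE IHf ?IHg// => a af; apply: rhoV; rewrite inE af ?orbT//.
Qed.

Local Open Scope classical_set_scope.
Local Open Scope ring_scope.

(** * Probabilities of formulas as measures of events *)

Section StochasticValuations.
Context (R : realType) (V : stochastic_valuation R).

(** Each outcome [w] gives a classical valuation, so classical reasoning about formulas becomes set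
    algebra on events. *)
Definition sv_event (a : pform) : set (sv_space V) :=
  [set w | psat (fun j => V j w) a].

Lemma measurable_sv_event a : measurable (sv_event a).
Proof.
elim: a => [j|a IH|a IHa b IHb].
- rewrite (_ : sv_event _ = V j @^-1` [set true]) //.
  exact: measurable_funPTI.
- rewrite (_ : sv_event _ = ~` sv_event a); first exact: measurableC.
  by apply/seteqP; split=> w /negP.
- rewrite (_ : sv_event _ = ~` sv_event a `|` sv_event b).
    by apply: measurableU => //; exact: measurableC.
  apply/seteqP; split=> w /=; rewrite /sv_event /= implybE.
    by case/orP => [/negP|]; [left|right].
  by case=> [/negP ->//|->]; rewrite orbT.
Qed.

(* The events V_{B_a} = U, for U in [[a]], partition [sv_event a]. *)
Lemma probE a : prob V a = fine (sv_prob V (sv_event a)).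
Proof.
pose F (U : {fset nat}) : set (sv_space V) :=
  \bigcap_(j in [set` psyms a]) (V j @^-1` [set (j \in U)]).
pose tr w := [fset j in psyms a | V j w]%fset.
(* [F U] tests only the symbols of [a], so it determines [U] only among the parts of [psyms a]. *)
have FE w U : (U `<=` psyms a)%fset -> F U w <-> tr w = U.
  move=> Ua; split=> [FUw|<- j /= ja]; last by rewrite !inE /= ja.
  apply/fsetP => j; rewrite !inE /=; case: (boolP (j \in psyms a)) => ja /=.
    exact: FUw.
  by apply/esym/negbTE; apply: contra ja; exact: (fsubsetP Ua).
have pdenS U : pden a U -> (U `<=` psyms a)%fset.
  by move=> [v _ <-]; exact: fset_sub.
have mF U : measurable (F U).
  apply: fin_bigcap_measurable => // j _; exact: measurable_funPTI.
have -> : sv_event a = \bigcup_(U in pden a) F U.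
  apply/seteqP; split=> w /= [].
    move=> wa; exists (tr w); first exact/psat_pden.
    by apply/FE => //; exact: fset_sub.
  move=> U aU /(FE _ _ (pdenS _ aU)) trw.
  by apply/psat_pden; rewrite -/(tr w) trw.
rewrite measure_fin_bigcup//; last 2 first.
- exact: pden_finite.
- move=> U U' aU aU' [w [/(FE _ _ (pdenS _ aU)) <-]].
  by move/(FE _ _ (pdenS _ aU')).
rewrite (eq_fsbigr (fun U => (prob_eq V (psyms a) U)%:E)).
  by rewrite fsumEFin//; exact: pden_finite.
by move=> U _; rewrite /prob_eq fineK //; apply: fin_num_measure; exact: mF.
Qed.

Lemma prob_ge0 a : 0 <= prob V a.
Proof. by rewrite probE fine_ge0. Qed.

Lemma prob_le1 a : prob V a <= 1.
Proof.
rewrite probE -lee_fin fineK ?fin_num_measure//; last exact: measurable_sv_event.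
by apply: probability_le1; exact: measurable_sv_event.
Qed.

Lemma prob_valid a : pvalid a -> prob V a = 1.
Proof.
move=> va; rewrite probE (_ : sv_event a = setT) ?probability_setT//.
by apply/seteqP; split=> w // _; exact: va.
Qed.

(** Finite additivity, with incompatibility and covering checked on classical valuations, since
    every outcome is one. *)
Lemma prob_disjoint_cases (s : seq pform) a : uniq s ->
  {in s &, forall b c v, psat v b -> psat v c -> b = c} ->
  (forall v, psat v a = has (psat v) s) ->
  prob V a = \sum_(b <- s) prob V b.
Proof.
move=> us disj aE; rewrite probE.
have -> : sv_event a = \bigcup_(b in [set` s]) sv_event b.
  apply/seteqP; split=> w; rewrite /sv_event /= aE.
    by move/hasP=> [b bs wb]; exists b.
  by move=> [b bs wb]; apply/hasP; exists b.
rewrite measure_fin_bigcup//; last 3 first.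
- exact: finite_seq.
- by move=> b c bs cs [w [wb wc]]; exact: (disj b c bs cs _ wb wc).
- by move=> b _; exact: measurable_sv_event.
rewrite -fsbig_seq// (eq_bigr (fun b => (prob V b)%:E)).
  by rewrite sumEFin.
move=> b _; rewrite probE fineK ?fin_num_measure//.
exact: measurable_sv_event.
Qed.

End StochasticValuations.

(** * Realizing a finite distribution *)

(** The space is [nat] with the sum of the Dirac masses at [i < n] weighted by [w i]; at outcome [i]
    the symbols take the values given by [v i]. *)
Lemma exists_finite_stochastic_valuation (R : realType) (n : nat)
    (w : nat -> R) (v : nat -> pvaluation) :
  (forall i, 0 <= w i) -> \sum_(i < n) w i = 1 ->
  exists V : stochastic_valuation R,
    forall a, prob V a = \sum_(i < n | psat (v i) a) w i.
Proof.
move=> w0 w1.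
pose m := msum
  (fun i => mscale (NngNum (w0 i)) (\d_i : {measure set nat -> \bar R})) n.
have mE A : m A = (\sum_(i < n | (i : nat) \in A) w i)%:E.
  rewrite /m /msum [in RHS]big_mkcond -sumEFin; apply: eq_bigr => i _.
  rewrite -[LHS]/((w i)%:E * \d_(i : nat) A)%E diracE -EFinM.
  by case: ifP; rewrite ?mulr1 ?mulr0.
have m1 : m setT = 1%E.
  by rewrite mE (eq_bigl xpredT) ?w1// => i; rewrite in_setT.
pose P : probability nat R := HB.pack m (Measure_isProbability.Build _ _ _ m m1).
have mV j : measurable_fun setT (fun i => v i j : bool) by [].
pose X j : {RV P >-> bool} :=
  HB.pack (fun i => v i j) (isMeasurableFun.Build _ _ _ _ _ (mV j)).
exists (StochasticValuation X) => a.
rewrite probE /= [X in fine X](mE _) /=; apply: eq_bigl => i.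
by apply/idP/idP; rewrite inE.
Qed.

Lemma psat_phi_inj v A U U' : (U `<=` A)%fset -> (U' `<=` A)%fset ->
  psat v (phi A U) -> psat v (phi A U') -> U = U'.
Proof. by move=> UA U'A; rewrite !psat_phi// => /eqP <- /eqP. Qed.

(** The argument is semantic: the indicator of [U] satisfies [phi A U], hence also the equal formula
    [phi A U'], which forces [U = U']. *)
Lemma phi_inj A : {in fpowerset A &, injective (phi A)}.
Proof.
move=> U U'; rewrite !fpowersetE => UA U'A E.
have sU : psat [in U] (phi A U).
  rewrite psat_phi//; apply/eqP/fsetP => j; rewrite !inE /=.
  by case: (boolP (j \in U)) => [/(fsubsetP UA) ->|]; rewrite ?andbF.
by apply: (psat_phi_inj UA U'A sU); rewrite -E.
Qed.

(** The formulas [phi A U] split the tautology [PTop] into incompatible cases. *)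
Lemma sum_prob_phi (R : realType) (V : stochastic_valuation R) A :
  \sum_(U <- fpowerset A) prob V (phi A U) = 1.
Proof.
rewrite -(@prob_valid _ V PTop); last by move=> v; exact: implybb.
rewrite (@prob_disjoint_cases _ V [seq phi A U | U <- fpowerset A]).
- by rewrite big_map.
- by rewrite map_inj_in_uniq ?fset_uniq//; exact: phi_inj.
- move=> _ _ /mapP[U + ->] /mapP[U' + ->]; rewrite !fpowersetE => UA U'A v vU.
  by move/(psat_phi_inj UA U'A vU) ->.
- move=> v; rewrite /= implybb; apply/esym/hasP.
  exists (phi A [fset j in A | v j]%fset).
    by apply: map_f; rewrite fpowersetE fset_sub.
  by rewrite psat_phi// fset_sub.
Qed.

(** The outcomes enumerate the parts of [A], each acting as its own indicator valuation. *)
Lemma exists_stochastic_valuation_phi (R : realType) (A : {fset nat})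
    (w : {fset nat} -> R) :
  (forall U, (U `<=` A)%fset -> 0 <= w U) ->
  \sum_(U <- fpowerset A) w U = 1 ->
  exists V : stochastic_valuation R,
    forall U, (U `<=` A)%fset -> prob V (phi A U) = w U.
Proof.
move=> w0 w1; pose s : seq {fset nat} := fpowerset A.
(* The default [fset0] is also a part of [A], so the weights are nonnegative at every index, even
   past the end of [s]. *)
have sA i : (nth fset0 s i `<=` A)%fset.
  rewrite -fpowersetE; case: (ltnP i (size s)) => si; first exact: mem_nth.
  by rewrite nth_default// fpowersetE fsub0set.
have [||V VE] := @exists_finite_stochastic_valuation R (size s)
  (w \o nth fset0 s) (fun i => [in nth fset0 s i]).
- by move=> i; apply: w0.
- by rewrite -w1 [RHS](big_nth fset0) big_mkord.
exists V => U UA; rewrite VE.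
have UE i : psat [in nth fset0 s i] (phi A U) = (nth fset0 s i == U).
  rewrite psat_phi//; congr (_ == U); apply/fsetP => j; rewrite !inE /=.
  by case: (boolP (j \in nth _ _ _)) => [/(fsubsetP (sA i)) ->|]; rewrite ?andbF.
rewrite (eq_bigl _ _ (fun i : 'I__ => UE i)) /=.
rewrite -(big_mkord (fun i => nth fset0 s i == U) (fun i => w (nth fset0 s i))).
rewrite -(big_nth fset0 (fun U' => U' == U) w).
(* [U] is listed exactly once in [fpowerset A], so a single term [w U] survives. *)
by rewrite -big_filter filter_pred1_uniq ?fset_uniq ?big_seq1//= /s fpowersetE.
Qed.

(** * Disjunctive normal forms and the reduction to RCOF *)

(** The shape [phi A U] makes distinct disjuncts incompatible and places their variables among those
    that Q constrains to be a distribution. *)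
Definition is_dnf (a : pform) (A : {fset nat}) (S : {fset pform}) : Prop :=
  {in S, forall b, exists2 U, (U `<=` A)%fset & b = phi A U} /\
  forall v, psat v a = has (psat v) S.

Lemma prob_is_dnf (R : realType) (V : stochastic_valuation R) a A S :
  is_dnf a A S -> prob V a = \sum_(b <- S) prob V b.
Proof.
move=> [SA aS]; apply: prob_disjoint_cases => //; first exact: fset_uniq.
move=> _ _ /SA[U UA ->] /SA[U' U'A ->] v vU vU'.
by rewrite (psat_phi_inj UA U'A vU vU').
Qed.

Lemma dnf_algorithm_returns dnf a A : is_dnf_algorithm dnf ->
  (psyms a `<=` A)%fset -> exists2 S, returns (dnf a A) S & is_dnf a A S.
Proof.
move=> Hdnf aA; have [S [dS SA aS _]] := Hdnf a A aA; exists S => //; split.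
  by move=> b /SA [/is_litconj_phi + <-].
move=> v; rewrite -psat_POr_seq; have := aS v; rewrite /=.
by case: (psat v a); case: (psat v _).
Qed.

Lemma rsat_Qform (R : realType) (rho : rvar -> R) A ds :
  rsat rho (Qform A ds) <->
  [/\ forall U, (U `<=` A)%fset -> 0 <= rho (inr (phi A U)) <= 1,
      \sum_(U <- fpowerset A) rho (inr (phi A U)) = 1 &
      {in ds, forall d, rho (inr d.1) = \sum_(b <- enum_fset d.2) rho (inr b)}].
Proof.
rewrite /Qform !rsat_RAnd -map_comp.
have -> : rsat rho (REq (RAdd_seq [seq xvar (phi A U) | U <- fpowerset A]) ROne)
    <-> \sum_(U <- fpowerset A) rho (inr (phi A U)) = 1.
  by rewrite /= rterm_val_RAdd_seq.
have QE U : rsat rho (RAnd (RLe RZero (xvar (phi A U)))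
    (RLe (xvar (phi A U)) ROne)) <-> 0 <= rho (inr (phi A U)) <= 1.
  by rewrite rsat_RAnd !rsat_RLe; split=> [[-> ->]|/andP].
pose F (d : pform * {fset pform}) :=
  REq (xvar d.1) (RAdd_seq [seq xvar b | b <- enum_fset d.2]).
have FE d : rsat rho (F d) <->
    rho (inr d.1) = \sum_(b <- enum_fset d.2) rho (inr b).
  by rewrite /= rterm_val_RAdd_seq.
rewrite -/F (rsat_RAnd_seq rho F ds).
split=> [[[/rsat_RAnd_seq Q01 Q1] Qs]|[Q01 Q1 Qs]].
  split=> // [U UA|d /Qs/FE//].
  by apply/QE; apply: Q01; rewrite fpowersetE.
split; last by move=> d /Qs/FE.
by split=> //; apply/rsat_RAnd_seq => U; rewrite fpowersetE => /Q01/QE.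
Qed.

Lemma ppl_valid_rcof (R : realType) f ds :
  unzip1 ds = ppl_pforms f ->
  {in ds, forall d, is_dnf d.1 (ppl_syms f) d.2} ->
  ppl_valid R f <->
  rcof_valid R (RImp (Qform (ppl_syms f) ds) (ppl_to_rcof f)).
Proof.
move=> dsf dsP; set A := ppl_syms f; split=> [fP rho|fP V rho].
  move/rsat_Qform => [w0 w1 ws].
  have [||V VE] := @exists_stochastic_valuation_phi R A
    (fun U => rho (inr (phi A U))).
  - by move=> U /w0/andP[].
  - exact: w1.
  (* One assignment serves both sides: [V] matches [rho] on the disjuncts, and the last conjuncts of
     Q extend the agreement to each alpha_j by additivity. *)
  apply/(@rsat_ppl_to_rcof _ V rho rho); [by []| |exact: fP].
  move=> a; rewrite -[_ \in _]/(a \in enum_fset _) -dsf => /mapP[d dds ->].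
  rewrite (ws _ dds) (prob_is_dnf V (dsP _ dds)).
  have [dA _] := dsP _ dds; apply: eq_big_seq => b /dA [U UA ->].
  by rewrite VE.
(* The x_alpha can be reassigned freely, since satisfaction of [f] under [V] and [rho] reads only
   the x_k. *)
pose rho' (x : rvar) := match x with inl k => rho (inl k) | inr a => prob V a end.
apply/(@rsat_ppl_to_rcof _ V rho rho') => //; apply: fP.
apply/rsat_Qform; split.
- by move=> U _; rewrite prob_ge0 prob_le1.
- exact: sum_prob_phi.
- by move=> d /dsP; exact: prob_is_dnf.
Qed.

Theorem theorem6p3 (R : realType)
    (dnf : pform -> {fset nat} -> delay {fset pform})
    (rcof : rform -> delay bool)
    (Hdnf : is_dnf_algorithm dnf) (Hrcof : is_rcof_algorithm R rcof) :
  (forall f : pplform, terminates (A_PPL dnf rcof f)) /\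
  (forall f : pplform,
      (ppl_valid R f -> returns (A_PPL dnf rcof f) true) /\
      (~ ppl_valid R f -> returns (A_PPL dnf rcof f) false)).
Proof.
(* A returned Boolean equivalent to validity yields termination and both halves of correctness at
   once. *)
have A_PPL_returns f : exists b : bool,
    returns (A_PPL dnf rcof f) b /\ (b = true <-> ppl_valid R f).
  have [|ds [fds dsf dsP]] := @returns_drun_all _ _ (fun a => dnf a (ppl_syms f))
      (fun a => is_dnf a (ppl_syms f)) (ppl_pforms f).
    by move=> a /psyms_ppl_pforms; exact: dnf_algorithm_returns.
  have [b [rb bP]] := Hrcof _ (is_sentence_RAll_closure
    (RImp (Qform (ppl_syms f) ds) (ppl_to_rcof f))).
  exists b; split; first exact: returns_dbind fds rb.
  by rewrite bP rcof_valid_RAll_closure -(ppl_valid_rcof R dsf dsP).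
split=> f; have [b [fb bP]] := A_PPL_returns f; first by exists b.
split=> fP; first by rewrite (bP.2 fP) in fb.
by case: b fb bP => // _ [/(_ erefl)].
Qed.
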